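(* Let $K \ge 3$ be an integer, let $a_1,\dots,a_K, b_1,\dots,b_K \in \mathbb{R}$, and let $\mathbf{J}_+$ and $\mathbf{J}_-$ be the $K\times K$ real symmetric matrices whose entries are: $(\mathbf{J}_\pm)_{j,j} = b_j$ for $1\le j\le K$; $(\mathbf{J}_\pm)_{j,j+1} = (\mathbf{J}_\pm)_{j+1,j} = a_j$ for $1\le j\le K-1$; $(\mathbf{J}_\pm)_{1,K} = (\mathbf{J}_\pm)_{K,1} = \pm a_K$; and all other entries equal to zero. Define $$p(j) = \begin{cases} 2j-1, & j\in\{1,\dots,\lceil K/2\rceil\},\\ 2(K-j+1), & j\in\{\lceil K/2\rceil+1,\dots,K\}.\end{cases}$$ Then $p$ is a permutation of $\{1,\dots,K\}$, and, with $\mathbf{P} = [\mathbf{e}_{p(1)}, \mathbf{e}_{p(2)},\dots,\mathbf{e}_{p(K)}]$ the $K\times K$ permutation matrix whose $j$th column is $\mathbf{e}_{p(j)}$, both matrices $\mathbf{P}\mathbf{J}_+\mathbf{P}^*$ and $\mathbf{P}\mathbf{J}_-\mathbf{P}^*$ have bandwidth $2$ (i.e., they are pentadiagonal).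
   Context: Here $\mathbf{e}_j$ denotes the $j$th column of the $K\times K$ identity matrix. A $K\times K$ symmetric matrix $\mathbf{A} = (A_{j,k})$ is said to have bandwidth $b$ when $A_{j,k} = 0$ for all $j,k$ with $|j-k|>b$. *)

(* Defs.v *)
From mathcomp Require Import all_boot all_order all_algebra.
From mathcomp Require Import classical_sets functions reals.

Set Implicit Arguments.
Unset Strict Implicit.
Unset Printing Implicit Defensive.

Import GRing.Theory Num.Theory.
Local Open Scope ring_scope.

(* An index i : 'I_K stands for the index i.+1 in {1, ..., K}. *)

(* [periodic_jacobi s a b] is J_+ for s = 1 and J_- for s = -1. In the corner
   entries, a_K is [a] at whichever of the two indices has value K.-1.
   The cases are mutually exclusive as soon as 3 <= K. *)
Definition periodic_jacobi (R : realType) (K : nat) (s : R)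
    (a b : 'I_K -> R) : 'M[R]_K :=
  \matrix_(i < K, j < K)
    if i == j then b i
    else if j == i.+1 :> nat then a i
    else if i == j.+1 :> nat then a j
    else if (i == 0%N :> nat) && (j.+1 == K :> nat) then s * a j
    else if (i.+1 == K :> nat) && (j == 0%N :> nat) then s * a i
    else 0.

(* The argument and the value are 1-based; [uphalf K] is the ceiling of K/2. *)
Definition fold_index (K j : nat) : nat :=
  if (j <= uphalf K)%N then (2 * j - 1)%N else (2 * (K - j + 1))%N.

(* Column j is the standard basis vector e_(p j), with p := fold_index K. *)
Definition fold_mx (R : realType) (K : nat) : 'M[R]_K :=
  \matrix_(i < K, j < K) (i.+1 == fold_index K j.+1 :> nat)%:R.

Definition has_bandwidth (R : realType) (K : nat) (d : nat) (A : 'M[R]_K) :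
    Prop :=
  A^T = A /\ forall j k : 'I_K, (d < `|j - k|)%N -> A j k = 0.

(* Main.v *)
Require Import Defs.
From mathcomp Require Import all_boot all_order all_algebra all_fingroup.
From mathcomp Require Import classical_sets functions reals.
From mathcomp Require Import zify.

Local Open Scope classical_set_scope.
Local Open Scope ring_scope.

(** The nonzero pattern of [periodic_jacobi] is a cycle on the indices: an
    off-diagonal entry can be nonzero only between two cyclic neighbours. The
    map [fold_index] flattens this cycle onto a line, its first half going up
    through the odd numbers and its second half coming back down through the
    even ones, so that cyclic neighbours land at distance at most 2: consecutive
    indices in the same half are sent exactly 2 apart, and the two pairs where
    the halves meet are sent to {K - 1, K} and to {1, 2}. The corner entries
    are thus no further from the diagonal than the others, whatever their sign
    ([periodic_jacobi_eq0]).

    Conjugation by [fold_mx] moves the entry at (i, j) to the entry at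
    (p i, p j) ([fold_mx_conjE]), so the distance between images under
    [fold_index] is precisely the distance to the diagonal after conjugation
    ([has_bandwidth_fold_mx_conj]). *)

Lemma fold_index_bounds (K j : nat) :
  (1 <= j <= K)%N -> (1 <= fold_index K j <= K)%N.
Proof. by rewrite /fold_index; case: ifP; lia. Qed.

(** Each branch is injective, and the two branches take values of opposite
    parity. *)
Lemma fold_index_inj_in (K i j : nat) : (1 <= i <= K)%N -> (1 <= j <= K)%N ->
  fold_index K i = fold_index K j -> i = j.
Proof. by rewrite /fold_index; do 2 case: ifP; lia. Qed.

Lemma fold_ord_subproof (K : nat) (i : 'I_K) : ((fold_index K i.+1).-1 < K)%N.
Proof. by have := @fold_index_bounds K i.+1; have := ltn_ord i; lia. Qed.

Definition fold_ord (K : nat) (i : 'I_K) : 'I_K := Ordinal (fold_ord_subproof K i).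

Lemma fold_ordS (K : nat) (i : 'I_K) : (fold_ord K i).+1 = fold_index K i.+1.
Proof. by have := @fold_index_bounds K i.+1; have := ltn_ord i => /=; lia. Qed.

Lemma fold_ord_inj (K : nat) : injective (fold_ord K).
Proof.
move=> i j eq_ij; apply/val_inj/succn_inj/(@fold_index_inj_in K) => //=.
by rewrite -!fold_ordS eq_ij.
Qed.

Definition fold_perm (K : nat) : 'S_K := perm (@fold_ord_inj K).

Lemma fold_permS (K : nat) (i : 'I_K) :
  (fold_perm K i).+1 = fold_index K i.+1.
Proof. by rewrite permE fold_ordS. Qed.

(** Surjectivity is inherited from [fold_perm], where it follows from
    injectivity on a finite type. *)
Lemma fold_index_bij (K : nat) :
  set_bij [set j : nat | (1 <= j <= K)%N] [set j : nat | (1 <= j <= K)%N]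
    (fold_index K).
Proof.
split=> [j /= | i j | m /= m_le].
- exact: fold_index_bounds.
- by rewrite !inE; apply: fold_index_inj_in.
- have m_lt : (m.-1 < K)%N by lia.
  pose i := ((fold_perm K)^-1)%g (Ordinal m_lt).
  exists i.+1; first by have := ltn_ord i => /=; lia.
  by rewrite -fold_permS permKV /=; lia.
Qed.

(** The inverse appears because [perm_mx s] has its ones at the positions
    (i, s i), while the columns of [fold_mx], not its rows, are indexed by the
    argument of [fold_index]. *)
Lemma fold_mxE (R : realType) (K : nat) :
  fold_mx R K = perm_mx (fold_perm K)^-1.
Proof.
apply/matrixP=> i j; rewrite !mxE -fold_permS eqSS.
by rewrite (can2_eq (permKV _) (permK _)).
Qed.

Lemma fold_mx_conjE (R : realType) (K : nat) (A : 'M[R]_K) (i j : 'I_K) :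
  (fold_mx R K *m A *m (fold_mx R K)^T) (fold_perm K i) (fold_perm K j) = A i j.
Proof.
by rewrite fold_mxE tr_perm_mx -col_permE -row_permE !mxE !permK.
Qed.

Lemma has_bandwidth_fold_mx_conj (R : realType) (K d : nat) (A : 'M[R]_K) :
  A^T = A ->
  (forall i j : 'I_K,
     (d < `|fold_index K i.+1 - fold_index K j.+1|)%N -> A i j = 0) ->
  has_bandwidth d (fold_mx R K *m A *m (fold_mx R K)^T).
Proof.
move=> symA A0; split; first by rewrite !trmx_mul trmxK symA mulmxA.
move=> j k; rewrite -(permKV (fold_perm K) j) -(permKV (fold_perm K) k).
rewrite fold_mx_conjE => lt_d; apply: A0; rewrite -!fold_permS; lia.
Qed.

(** Off the diagonal, the cases of the definition come in transposed pairs, and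
    the two cases of a pair exclude each other, so the order in which they are
    tested cannot break the symmetry. *)
Lemma periodic_jacobi_sym (R : realType) (K : nat) (s : R) (a b : 'I_K -> R) :
  (periodic_jacobi s a b)^T = periodic_jacobi s a b.
Proof.
apply/matrixP=> i j; rewrite !mxE.
have [->//|] := eqVneq i j.
rewrite eq_sym => /negPf ne_ij.
move: ne_ij; rewrite -(inj_eq val_inj) /=.
have := ltn_ord i; have := ltn_ord j.
by do !case: ifP => //; lia.
Qed.

(** The contrapositive of the folding property: each case of the definition
    with a possibly nonzero value concerns equal or cyclically adjacent indices,
    whose images are at distance at most 2. *)
Lemma periodic_jacobi_eq0 (R : realType) (K : nat) (s : R) (a b : 'I_K -> R)
    (i j : 'I_K) :
  (2 < `|fold_index K i.+1 - fold_index K j.+1|)%N ->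
  periodic_jacobi s a b i j = 0.
Proof.
rewrite mxE -(inj_eq val_inj) /= /fold_index.
have := ltn_ord i; have := ltn_ord j.
by do !case: ifP => //; lia.
Qed.

Lemma has_bandwidth2_fold_jacobi (R : realType) (K : nat) (s : R)
    (a b : 'I_K -> R) :
  has_bandwidth 2 (fold_mx R K *m periodic_jacobi s a b *m (fold_mx R K)^T).
Proof.
apply: has_bandwidth_fold_mx_conj.
  exact: periodic_jacobi_sym.
by move=> i j; apply: periodic_jacobi_eq0.
Qed.

Theorem mainTheorem1 (R : realType) (K : nat) (hK : (3 <= K)%N)
    (a b : 'I_K -> R) :
  set_bij [set j : nat | (1 <= j <= K)%N] [set j : nat | (1 <= j <= K)%N]
    (fold_index K) /\
  is_perm_mx (fold_mx R K) /\
  has_bandwidth 2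
    (fold_mx R K *m periodic_jacobi 1 a b *m (fold_mx R K)^T) /\
  has_bandwidth 2
    (fold_mx R K *m periodic_jacobi (-1) a b *m (fold_mx R K)^T).
Proof.
split; first exact: fold_index_bij.
split; first by rewrite fold_mxE perm_mx_is_perm.
by split; apply: has_bandwidth2_fold_jacobi.
Qed.
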